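(* Let $G$ be a finite graph, $\mathcal L$ a non-trivial linear class of bonds of $G$, and $J(G,\mathcal L)=J_0(G,\mathcal L)/e_0$. Then the cocircuits of $J(G,\mathcal L)$ are exactly: (1) the bonds of $G$ in $\mathcal L$, and (2) the tribonds and dibonds of $G$ that do not contain (as a subset) any bond in $\mathcal L$. Furthermore, if $N$ is an elementary quotient of the graphic matroid $M(G)$ (i.e., $N=N'/e_0$ for a matroid $N'$ with $N'\setminus e_0=M(G)$ in which $e_0$ is neither a loop nor a coloop), then $N=J(G,\mathcal L)$ for some non-trivial linear class of bonds $\mathcal L$ of $G$.
   Context: Graphs are finite and may have loops and multiple edges; a link is a non-loop edge. For $X\subseteq V(G)$, $\delta(X)$ is the set of links with exactly one endpoint in $X$. A bond is a minimal nonempty edge cut of $G$. A tribond is a set $\delta(X_1)\cup\delta(X_2)\cup\delta(X_3)$ where $\{X_1,X_2,X_3\}$ is a partition of the vertex set of one connected component of $G$ into nonempty sets, each $G[X_i]$ connected, with at least one edge joining each pair $X_i,X_j$. A linear class of bonds is a set $\mathcal L$ of bonds such that for every such tripartition the number of $i$ with $\delta(X_i)\in\mathcal L$ is not exactly two; it is trivial if it contains all bonds. Bonds $B_1,B_2$ form a modular pair if $G-(B_1\cup B_2)$ has exactly two more components than $G$; a dibond is the union of a modular pair of bonds that is not a tribond. For non-trivial $\mathcal L$, the complete join matroid $J_0(G,\mathcal L)$ is the matroid on $E(G)\cup\{e_0\}$ ($e_0$ a new element) whose cocircuits are: the bonds in $\mathcal L$; the sets $B\cup\{e_0\}$ for bonds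 $B\notin\mathcal L$; and the tribonds and dibonds containing no bond of $\mathcal L$. (Such a matroid exists and is a single-element extension of $M(G)$ in which $e_0$ is neither a loop nor a coloop.) *)

(* Defs.v *)
From mathcomp Require Import all_boot.
From mathcomp Require Import boolp.

Set Implicit Arguments.
Unset Strict Implicit.
Unset Printing Implicit Defensive.

(* The ground set is the whole type [E]. *)
Record matroid (E : finType) := Matroid {
  indep : {set {set E}};
  indep0 : set0 \in indep;
  indep_sub : forall I J : {set E}, I \subset J -> J \in indep -> I \in indep;
  indep_aug : forall I J : {set E}, I \in indep -> J \in indep -> #|I| < #|J| ->
    exists2 e, e \in J :\: I & e |: I \in indep
}.

Lemma matroid_ext (E : finType) (M N : matroid E) : indep M = indep N -> M = N.
Proof.
case: M N => [I a b c] [J a' b' c'] /= eqIJ; case: J / eqIJ a' b' c' => a' b' c'.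
by congr Matroid; apply: Prop_irrelevance.
Qed.

Definition circuits (E : finType) (M : matroid E) : {set {set E}} :=
  [set C | minset (fun X => X \notin indep M) C].

Definition bases (E : finType) (M : matroid E) : {set {set E}} :=
  [set B | maxset (fun X => X \in indep M) B].

Section Dual.
Variables (E : finType) (M : matroid E).

Lemma indep_extend (I A : {set E}) : I \in indep M -> I \subset A ->
  exists2 B, maxset (fun X => (X \in indep M) && (X \subset A)) B & I \subset B.
Proof.
move=> iI sIA.
by have [|B mB sIB] := @maxset_exists _ (fun X => (X \in indep M) && (X \subset A)) I;
  [rewrite iI | exists B].
Qed.

Lemma leq_base (B I : {set E}) : B \in bases M -> I \in indep M -> #|I| <= #|B|.
Proof.
rewrite inE => /maxsetP[iB mB] iI; rewrite leqNgt; apply/negP => ltBI.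
have [e /setDP[_ eB] ieB] := indep_aug iB iI ltBI.
by case/negP: eB; rewrite -(mB _ ieB (subsetUr _ _)) setU11.
Qed.

(* Its bases are the complements of the bases of [M]. *)
Definition dual_indep : {set {set E}} :=
  [set X : {set E} | [exists B in bases M, [disjoint X & B]]].

Lemma dual_indepP (X : {set E}) :
  reflect (exists2 B, B \in bases M & [disjoint X & B]) (X \in dual_indep).
Proof. by rewrite inE; apply: exists_inP. Qed.

Lemma dual_indep0 : set0 \in dual_indep.
Proof.
apply/dual_indepP.
have [B /maxsetP[/andP[iB _] mB] _] := indep_extend (indep0 M) (sub0set setT).
exists B; last by rewrite -setI_eq0 set0I.
rewrite inE; apply/maxsetP; split=> // C iC sBC.
by apply: mB => //; rewrite iC subsetT.
Qed.

Lemma dual_indep_sub (I J : {set E}) :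
  I \subset J -> J \in dual_indep -> I \in dual_indep.
Proof.
move=> sIJ /dual_indepP[B bB dJB]; apply/dual_indepP; exists B => //.
exact: disjointWl dJB.
Qed.

Lemma dual_indep_aug (I J : {set E}) :
  I \in dual_indep -> J \in dual_indep -> #|I| < #|J| ->
  exists2 e, e \in J :\: I & e |: I \in dual_indep.
Proof.
move=> /dual_indepP[BI bBI dI] /dual_indepP[BJ bBJ dJ] ltIJ.
have iBI : BI \in indep M by move: bBI; rewrite inE => /maxsetP[].
have iBJ : BJ \in indep M by move: bBJ; rewrite inE => /maxsetP[].
have iBJI : BJ :\: I \in indep M by apply: indep_sub iBJ; apply: subsetDl.
have [B /maxsetP[/andP[iB sB] mB] sBJB] :=
  indep_extend iBJI (subsetUl (BJ :\: I) BI).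
have cBI : #|BI| <= #|B|.
  rewrite leqNgt; apply/negP => ltB.
  have [e /setDP[eBI eB] ieB] := indep_aug iB iBI ltB.
  case/negP: eB; rewrite -(mB (e |: B)) ?setU11 ?subsetUr // ieB /=.
  by rewrite subUset sB andbT sub1set inE eBI orbT.
have bB : B \in bases M.
  rewrite inE; apply/maxsetP; split=> // C iC sBC.
  apply/esym/eqP; rewrite eqEcard sBC /=.
  exact: leq_trans (leq_base bBI iC) cBI.
have dIB : [disjoint I & B].
  apply: disjointWr sB _; rewrite -setI_eq0 setIUr setU_eq0 [I :&: BI == _]setI_eq0 dI andbT.
  by apply/eqP/setP=> x; rewrite !inE; case: (x \in I).
have [sJIB|] := boolP (J :\: I \subset B); last first.
  case/subsetPn=> e eJI eB; exists e => //; apply/dual_indepP; exists B => //.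
  by rewrite -setI_eq0 setIUl setU_eq0 !setI_eq0 dIB andbT disjoints1.
have : #|(BJ :\: I) :|: (J :\: I)| <= #|BJ|.
  apply: leq_trans (leq_base bBJ iB); apply: subset_leq_card.
  by rewrite subUset sBJB.
have/eqP dd : (BJ :\: I) :&: (J :\: I) == set0.
  rewrite setI_eq0; apply: disjointWl (subsetDl _ _) _.
  by apply: disjointWr (subsetDl _ _) _; rewrite disjoint_sym.
rewrite cardsU dd cards0 subn0 leqNgt => /negP[].
rewrite -{1}(cardsID I BJ) addnC ltn_add2l.
apply: (@leq_ltn_trans #|I :\: J|).
  apply: subset_leq_card; apply/subsetP=> x; rewrite !inE => /andP[xB ->].
  by rewrite andbT (contraL _ xB) // => xJ; rewrite (disjointFr dJ xJ).
rewrite -(ltn_add2l #|I :&: J|) cardsID.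
by rewrite setIC cardsID.
Qed.

Definition dual : matroid E := Matroid dual_indep0 dual_indep_sub dual_indep_aug.

End Dual.

Definition cocircuits (E : finType) (M : matroid E) : {set {set E}} :=
  circuits (dual M).

Definition loop (E : finType) (M : matroid E) (e : E) : Prop :=
  [set e] \in circuits M.

Definition coloop (E : finType) (M : matroid E) (e : E) : Prop :=
  [set e] \in circuits (dual M).

(* A matroid on [E] together with one new element e0 is a matroid on
   [option E], where [None] plays the role of e0. *)

Section DeleteContract.
Variables (E : finType) (N : matroid (option E)).

Definition delete0_indep : {set {set E}} :=
  [set X : {set E} | Some @: X \in indep N].

Lemma delete0_indep0 : set0 \in delete0_indep.
Proof. by rewrite inE imset0 indep0. Qed.

Lemma delete0_indep_sub (I J : {set E}) :
  I \subset J -> J \in delete0_indep -> I \in delete0_indep.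
Proof. by rewrite !inE => sIJ; apply/indep_sub/imsetS. Qed.

Lemma delete0_indep_aug (I J : {set E}) :
  I \in delete0_indep -> J \in delete0_indep -> #|I| < #|J| ->
  exists2 e, e \in J :\: I & e |: I \in delete0_indep.
Proof.
rewrite !inE => iI iJ ltIJ.
have injS : injective (@Some E) by move=> x y [].
have [|e] := indep_aug iI iJ; first by rewrite !card_imset.
case/setDP=> /imsetP[x xJ ->]; rewrite mem_imset // => xI ix.
by exists x; rewrite !inE ?xI // imsetU1.
Qed.

Definition delete0 : matroid E :=
  Matroid delete0_indep0 delete0_indep_sub delete0_indep_aug.

End DeleteContract.

Definition contract0 (E : finType) (N : matroid (option E)) : matroid E :=
  dual (delete0 (dual N)).

Definition elementary_quotient (E : finType) (M N : matroid E) : Prop :=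
  exists N' : matroid (option E),
    [/\ delete0 N' = M, ~ loop N' None, ~ coloop N' None & N = contract0 N'].

(* Loops and parallel edges are allowed; the order of the two ends of an edge
   carries no information. *)
Record graph := Graph {
  vertex : finType;
  edge : finType;
  ends : edge -> vertex * vertex
}.

Section GraphDefs.
Variable G : graph.
Implicit Types (e : edge G) (x y : vertex G) (X : {set vertex G}).
Implicit Types (F B C D : {set edge G}) (L : {set {set edge G}}).

Definition joins e x y : bool := (ends e == (x, y)) || (ends e == (y, x)).

(* Loops never belong to [delta X]. *)
Definition delta X : {set edge G} :=
  [set e | ((ends e).1 \in X) (+) ((ends e).2 \in X)].

Definition adj F x y : bool := [exists e in F, joins e x y].

(* The vertex sets of the components of the spanning subgraph (V(G), F). *)
Definition components F : {set {set vertex G}} :=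
  [set [set y | connect (adj F) x y] | x in vertex G].

Definition connected_on X : bool :=
  (X != set0) &&
  [forall x in X, forall y in X,
     connect (fun u v => [&& u \in X, v \in X & adj setT u v]) x y].

Definition edge_between X1 X2 : bool :=
  [exists e, exists x in X1, exists y in X2, joins e x y].

Definition bonds : {set {set edge G}} :=
  [set B | minset (fun C => (C != set0) && [exists X, C == delta X]) B].

Definition tripartition X1 X2 X3 : bool :=
  [&& X1 :|: X2 :|: X3 \in components setT,
      [&& [disjoint X1 & X2], [disjoint X1 & X3] & [disjoint X2 & X3]],
      [&& connected_on X1, connected_on X2 & connected_on X3] &
      [&& edge_between X1 X2, edge_between X1 X3 & edge_between X2 X3]].

Definition tribonds : {set {set edge G}} :=
  [set D | [exists X1, exists X2, exists X3,
     tripartition X1 X2 X3 && (D == delta X1 :|: delta X2 :|: delta X3)]].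

Definition linear_class L : Prop :=
  L \subset bonds /\
  forall X1 X2 X3, tripartition X1 X2 X3 ->
    ((delta X1 \in L) + (delta X2 \in L) + (delta X3 \in L) <> 2)%N.

Definition nontrivial L : Prop := ~~ (bonds \subset L).

Definition modular_pair B1 B2 : bool :=
  [&& B1 \in bonds, B2 \in bonds &
      #|components (~: (B1 :|: B2))| == #|components setT| + 2].

Definition dibonds : {set {set edge G}} :=
  [set D | (D \notin tribonds) &&
     [exists B1, exists B2, modular_pair B1 B2 && (D == B1 :|: B2)]].

(* [J0] is the complete join matroid J_0(G, L).  A matroid is determined by its
   cocircuits, so for given [L] at most one [J0] satisfies this. *)
Definition complete_join L (J0 : matroid (option (edge G))) : Prop :=
  cocircuits J0 =
    [set Some @: B | B : {set edge G} in L]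
    :|: [set None |: Some @: B | B : {set edge G} in bonds :\: L]
    :|: [set Some @: D | D : {set edge G} in
          [set D in tribonds :|: dibonds | [forall B in L, ~~ (B \subset D)]]].

(* [walk x es p]: from [x], the edges [es] lead successively to the vertices
   [p]. *)
Fixpoint walk x (es : seq (edge G)) (p : seq (vertex G)) : bool :=
  match es, p with
  | [::], [::] => true
  | e :: es', y :: p' => joins e x y && walk y es' p'
  | _, _ => false
  end.

(* A loop is a cycle of length 1, two parallel edges form one of length 2. *)
Definition is_cycle C : Prop :=
  exists x es p,
    [/\ walk x es p, last x p = x, es != [::], uniq p & uniq es] /\
    C = [set:: es].

Definition forest F : Prop := forall C, is_cycle C -> ~~ (C \subset F).

Lemma joinsC e x y : joins e x y = joins e y x.
Proof. by rewrite /joins orbC. Qed.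

Lemma adj_sym F : symmetric (adj F).
Proof. by move=> x y; apply: eq_existsb => e; rewrite joinsC. Qed.

Lemma conn_sym F x y : connect (adj F) x y = connect (adj F) y x.
Proof. exact: (sym_connect_sym (@adj_sym F)). Qed.

Lemma conn_sub F F' x y :
  F \subset F' -> connect (adj F) x y -> connect (adj F') x y.
Proof.
move=> /subsetP sF; apply: connect_sub => u v /existsP[e /andP[eF je]].
by apply: connect1; apply/existsP; exists e; rewrite sF.
Qed.

Lemma joins_ends e : joins e (ends e).1 (ends e).2.
Proof. by rewrite /joins -surjective_pairing eqxx. Qed.

Definition spans F e : bool := connect (adj F) (ends e).1 (ends e).2.

Lemma joins_spans F e x y : joins e x y -> spans F e = connect (adj F) x y.
Proof. by rewrite /spans => /orP[] /eqP -> //=; rewrite conn_sym. Qed.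

Lemma spans_mem F e : e \in F -> spans F e.
Proof.
by move=> eF; apply: connect1; apply/existsP; exists e; rewrite eF joins_ends.
Qed.

Lemma spans_conn F F' x y :
  {in F', forall e, spans F e} -> connect (adj F') x y -> connect (adj F) x y.
Proof.
move=> sF; apply: connect_sub => u v /existsP[e /andP[eF je]].
by rewrite -(joins_spans _ je) sF.
Qed.

Lemma forest_sub F F' : F \subset F' -> forest F' -> forest F.
Proof.
by move=> sF fF' C cC; apply: contra (fF' C cC) => sC; apply: subset_trans sF.
Qed.

Lemma walk_cat x es1 e es2 p : walk x (es1 ++ e :: es2) p ->
  exists p1 y p2, [/\ p = p1 ++ y :: p2, walk x es1 p1,
    joins e (last x p1) y & walk y es2 p2].
Proof.
elim: es1 x p => [|e1 es1 IH] x [|z p] //= /andP[je w].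
  by exists [::], z, p.
have [p1 [y [p2 [-> w1 j w2]]]] := IH _ _ w.
by exists (z :: p1), y, p2; rewrite /= je.
Qed.

Lemma walk_conn F x es p :
  {subset es <= F} -> walk x es p -> connect (adj F) x (last x p).
Proof.
elim: es x p => [|e es IH] x [|y p] //= sF /andP[je w].
apply: connect_trans (IH _ _ _ w); last first.
  by move=> f fes; apply: sF; rewrite inE fes orbT.
by apply: connect1; apply/existsP; exists e; rewrite je sF // mem_head.
Qed.

Lemma forestU1 F e : forest F -> ~~ spans F e -> forest (e |: F).
Proof.
move=> fF nsp C cC; apply/negP => sC; case/negP: nsp.
have [x [es [p [[w lst _ up ues] defC]]]] := cC.
have [ees|ees] := boolP (e \in es); last first.
  case/negP: (fF C cC); apply/subsetP => f fC.
  have := subsetP sC f fC; rewrite !inE => /predU1P[fe|//].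
  by move: fC; rewrite defC inE fe (negPf ees).
have sF : {in es, forall f, f != e -> f \in F}.
  move=> f fes; have := subsetP sC f; rewrite defC !inE => /(_ fes).
  by case/predU1P=> [->|//]; rewrite eqxx.
case/splitPr: ees w ues sF {sC defC cC up} => es1 es2 w.
rewrite cat_uniq /= negb_or => /and3P[_ /andP[e1 _] /andP[e2 _]] sF.
have [p1 [y [p2 [dp w1 j w2]]]] := walk_cat w.
rewrite (joins_spans _ j) conn_sym.
apply: (@connect_trans _ _ x).
  have <- : last y p2 = x by move: lst; rewrite dp last_cat.
  apply: walk_conn w2 => f fes; apply: sF; first by rewrite mem_cat inE fes !orbT.
  by apply: contraNneq e2 => <-.
apply: walk_conn w1 => f fes; apply: sF; first by rewrite mem_cat fes.
by apply: contraNneq e1 => <-.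
Qed.

Lemma path_walk F x p : path (adj F) x p -> exists2 es, walk x es p & {subset es <= F}.
Proof.
elim: p x => [|y p IH] x /=; first by exists [::].
case/andP=> /existsP[e /andP[eF je]] /IH[es w sF].
exists (e :: es); first by rewrite /= je.
by move=> f; rewrite inE => /predU1P[->|/sF].
Qed.

Lemma walk_joins x es p e u v :
  walk x es p -> e \in es -> joins e u v -> u \in x :: p.
Proof.
elim: es x p => [|f es IH] x [|y p] //= /andP[jf w].
rewrite inE => /predU1P[->|ees] je; last by rewrite inE (IH _ _ w ees je) orbT.
by case/orP: jf => /eqP ef; case/orP: je; rewrite ef => /eqP[-> ->];
  rewrite !inE eqxx ?orbT.
Qed.

Lemma walk_uniq x es p : walk x es p -> uniq (x :: p) -> uniq es.
Proof.
elim: es x p => [|e es IH] x [|y p] // /andP[je w] /andP[xp up].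
rewrite cons_uniq (IH _ _ w up) andbT.
by apply: contra xp => ees; apply: walk_joins w ees je.
Qed.

Lemma walk_rcons x es p e y :
  walk x es p -> joins e (last x p) y -> walk x (rcons es e) (rcons p y).
Proof.
by elim: es x p => [|f es IH] x [|z p] //= => [_ ->|/andP[-> w] /(IH _ _ w)].
Qed.

Lemma spans_forest F e : e \notin F -> forest (e |: F) -> ~~ spans F e.
Proof.
move=> eF fF; apply/negP; rewrite /spans.
set u := (ends e).1; set v := (ends e).2 => /connectP[p0 /shortenP[p pp up _] lst].
have [es w sF] := path_walk pp.
suff cC : is_cycle [set:: rcons es e].
  case/negP: (fF _ cC); apply/subsetP => f.
  by rewrite !inE mem_rcons inE => /predU1P[->|/sF ->]; rewrite ?eqxx ?orbT.
exists u, (rcons es e), (rcons p u); split=> //; split.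
- by apply: walk_rcons w _; rewrite -lst joinsC joins_ends.
- by rewrite last_rcons.
- by rewrite -size_eq0 size_rcons.
- by rewrite rcons_uniq; move: up; rewrite cons_uniq.
- by rewrite rcons_uniq (walk_uniq w up) andbT; apply: contra eF; apply: sF.
Qed.

Lemma forest_leq F F' :
  forest F' -> {in F', forall e, spans F e} -> #|F'| <= #|F|.
Proof.
have [n] := ubnP #|F' :\: F|; elim: n F' => // n IH F' ltn fF' sF'.
have [|/subsetPn[f mf fF]] := boolP (F' \subset F); first exact: subset_leq_card.
have nsp : ~~ spans (F' :\ f) f.
  by apply: spans_forest; rewrite ?setD1K // !inE eqxx.
have [g gF ng] : exists2 g, g \in F & ~~ spans (F' :\ f) g.
  apply/exists_inP; apply: contraNT nsp => /exists_inPn H.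
  apply: spans_conn (sF' f mf) => g /H; by rewrite negbK.
have gF' : g \notin F' :\ f by apply: contra ng; apply: spans_mem.
have <- : #|g |: (F' :\ f)| = #|F'|.
  by rewrite cardsU1 gF' [RHS](cardsD1 f) mf.
apply: IH.
- rewrite -ltnS; apply: leq_trans ltn; rewrite ltnS.
  apply: proper_card; apply/properP; split.
    apply/subsetP=> h; rewrite !inE => /andP[hF /predU1P[hg|/andP[_ ->]]].
      by rewrite hg gF in hF.
    by rewrite hF.
  exists f; rewrite !inE ?mf ?fF //= eqxx /= orbF.
  by apply: contraNneq fF => ->.
- by apply: forestU1 => //; apply: forest_sub fF'; apply: subsetDl.
- move=> h; rewrite !inE => /predU1P[->|/andP[_ /sF' //]].
  exact: spans_mem.
Qed.

Definition forests : {set {set edge G}} := [set F | `[< forest F >]].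

Lemma forestsP F : reflect (forest F) (F \in forests).
Proof. by rewrite inE; apply: asboolP. Qed.

Lemma forests0 : set0 \in forests.
Proof.
apply/forestsP => C [x [es [p [[_ _ nes _ _] ->]]]]; apply: contra nes.
by case: es => // e es /subsetP/(_ e); rewrite !inE eqxx => /(_ isT).
Qed.

Lemma forests_sub (I J : {set edge G}) :
  I \subset J -> J \in forests -> I \in forests.
Proof. by move=> sIJ /forestsP fJ; apply/forestsP; apply: forest_sub fJ. Qed.

Lemma forests_aug (I J : {set edge G}) :
  I \in forests -> J \in forests -> #|I| < #|J| ->
  exists2 e, e \in J :\: I & e |: I \in forests.
Proof.
move=> /forestsP fI /forestsP fJ ltIJ.
have [/exists_inP[e eJ ne]|/exists_inPn H] :=
  boolP [exists e in J, ~~ spans I e].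
  exists e; first by rewrite inE eJ andbT; apply: contra ne; apply: spans_mem.
  by apply/forestsP; apply: forestU1.
have := @forest_leq I J fJ; rewrite leqNgt ltIJ => /(_ _)/negP[] // e /H.
by rewrite negbK.
Qed.

Definition graphic_matroid : matroid (edge G) :=
  Matroid forests0 forests_sub forests_aug.

End GraphDefs.

(* Main.v *)
(* Let P be the dual of a one-element extension N' of M(G), and let Q be the
   dual of M(G). Since e0 is not a coloop of N', Q is the contraction P / e0, and
   the nullity of X in Q is that of X + e0 in P. The circuits of Q are the bonds
   of G, and the tribonds and dibonds are exactly the unions of two circuits of Q
   that have nullity 2 in Q. A circuit of P through e0 is B + e0 with B a circuit
   of Q that is not a circuit of P. A circuit D of P avoiding e0 has nullity at
   most 2 in Q, so either D is itself a circuit of Q, or it has nullity 2 and, as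
   deleting any of its elements lowers the nullity in Q, is a union of two
   circuits. Hence N' is the complete join of the class L of those bonds that are
   circuits of P. This class is linear: if two of the three bonds of a
   tripartition lie in L, their union has nullity 2 in both P and Q, so e0 is not
   spanned by it and the third bond is also a circuit of P. *)
Require Import Defs.
From mathcomp Require Import all_boot zify.

Set Implicit Arguments.
Unset Strict Implicit.
Unset Printing Implicit Defensive.

(** * Rank, nullity and circuits of a matroid *)

Section Nullity.
Variables (E : finType) (M : matroid E).
Implicit Types (I B C X Y : {set E}) (x : E).

Lemma circuitP C :
  reflect (C \notin indep M /\ forall x, x \in C -> C :\ x \in indep M)
          (C \in circuits M).
Proof.
rewrite inE; apply: (iffP minsetP) => -[dC mC]; split=> //.
  move=> x xC; apply/negPn/negP => /mC /(_ (subsetDl _ _)) eC.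
  by move: xC; rewrite -eC !inE eqxx.
move=> Y dY sYC; apply/eqP; rewrite eqEsubset sYC; apply/subsetP => x xC.
apply: contraNT dY => xY; apply: indep_sub (mC x xC).
by rewrite subsetD1 sYC.
Qed.

Arguments circuitP {C}.

Lemma circuit_dep C : C \in circuits M -> C \notin indep M.
Proof. by case/circuitP. Qed.

Lemma circuit_min C X :
  C \in circuits M -> X \notin indep M -> X \subset C -> X = C.
Proof. by rewrite inE => /minsetP[_ mC]; apply: mC. Qed.

Lemma dep_circuit X : X \notin indep M -> exists2 C, C \in circuits M & C \subset X.
Proof.
move=> dX; have [C mC sCX] := @minset_exists _ (fun X => X \notin indep M) X dX.
by exists C; rewrite ?inE.
Qed.

Lemma sub_dep X Y : X \subset Y -> X \notin indep M -> Y \notin indep M.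
Proof. by move=> sXY; apply: contra; apply: indep_sub. Qed.

Definition rank X := \max_(I in indep M | I \subset X) #|I|.

Lemma leq_rank I X : I \in indep M -> I \subset X -> #|I| <= rank X.
Proof.
move=> iI sI; rewrite /rank.
pose p (I : {set E}) := (I \in indep M) && (I \subset X).
by apply: (@leq_bigmax_cond _ p (fun I => #|I|)); rewrite /p iI.
Qed.

Lemma rank_extend I X : I \in indep M -> I \subset X ->
  exists B, [/\ I \subset B, B \subset X, B \in indep M & #|B| = rank X].
Proof.
move=> iI sI; have [B /maxsetP[/andP[iB sB] mB] sIB] := indep_extend iI sI.
exists B; split=> //; apply/eqP; rewrite eqn_leq leq_rank //=.
apply/bigmax_leqP => J /andP[iJ sJ]; rewrite leqNgt; apply/negP => ltBJ.
have [e /setDP[eJ eB] ieB] := indep_aug iB iJ ltBJ.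
case/negP: eB; rewrite -(mB (e |: B)) ?setU11 ?subsetUr // ieB /=.
by rewrite subUset sB andbT sub1set (subsetP sJ).
Qed.

Lemma rank_basis X : exists B, [/\ B \subset X, B \in indep M & #|B| = rank X].
Proof.
by have [B [_ sB iB cB]] := rank_extend (indep0 M) (sub0set X); exists B.
Qed.

Lemma rank_card X : rank X <= #|X|.
Proof. by have [B [sB _ <-]] := rank_basis X; apply: subset_leq_card. Qed.

Lemma rankS X Y : X \subset Y -> rank X <= rank Y.
Proof.
move=> sXY; have [B [sB iB <-]] := rank_basis X.
by apply: leq_rank => //; apply: subset_trans sXY.
Qed.

Lemma rankU1 x X : rank (x |: X) <= (rank X).+1.
Proof.
have [B [sB iB <-]] := rank_basis (x |: X).
have : #|B :\ x| <= rank X.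
  by apply: leq_rank; [apply: indep_sub iB; apply: subsetDl | rewrite subDset].
by rewrite (cardsD1 x B); case: (x \in B) => /=; lia.
Qed.

Lemma baseP B : reflect (B \in indep M /\ #|B| = rank setT) (B \in bases M).
Proof.
rewrite inE; apply: (iffP maxsetP) => -[iB mB]; split=> //.
  have [C [sBC _ iC <-]] := rank_extend iB (subsetT B).
  by rewrite (mB C).
move=> C iC sBC; apply/esym/eqP; rewrite eqEcard sBC mB.
exact: leq_rank (subsetT _).
Qed.

Arguments baseP {B}.

Definition nullity X := #|X| - rank X.

Lemma nullity_rank X : nullity X + rank X = #|X|.
Proof. by rewrite subnK ?rank_card. Qed.

Lemma indep_nullity X : (X \in indep M) = (nullity X == 0).
Proof.
have nr := nullity_rank X; apply/idP/eqP => [iX|n0].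
  by have := leq_rank iX (subxx X); lia.
have [B [sB iB cB]] := rank_basis X.
suff <- : B = X by [].
by apply/eqP; rewrite eqEcard sB; lia.
Qed.

Lemma nullityU1 x X : nullity X <= nullity (x |: X) <= (nullity X).+1.
Proof.
have [xX|xX] := boolP (x \in X).
  by rewrite (setUidPr _) ?sub1set // leqnn leqnSn.
have := nullity_rank X; have := nullity_rank (x |: X).
have := rankU1 x X; have := rankS (subsetUr [set x] X).
by rewrite cardsU1 xX /=; lia.
Qed.

Lemma nullityS X Y : X \subset Y -> nullity X <= nullity Y.
Proof.
have [n] := ubnP #|Y :\: X|; elim: n X => // n IH X ltn sXY.
have [/eqP|[x /setDP[xY xX]]] := set_0Vmem (Y :\: X).
  by rewrite setD_eq0 => sYX; rewrite (_ : X = Y) //; apply/eqP; rewrite eqEsubset sXY.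
have /andP[le1 _] := nullityU1 x X; apply: leq_trans le1 (IH _ _ _).
- by move: ltn; rewrite (cardsD1 x) inE xY xX -addnS ltnS setDDl setUC.
- by rewrite subUset sub1set xY.
Qed.

(** Extend [C :\ x] to a basis [B] of [X]. It cannot contain [x], since it would then contain [C],
    so [X :\ x] has the rank of [X] and one element less. *)
Lemma nullityD1_circuit C X x : C \in circuits M -> C \subset X -> x \in C ->
  nullity X = (nullity (X :\ x)).+1.
Proof.
move=> cC sCX xC; have xX := subsetP sCX x xC.
have [dC /(_ x xC) iCx] := circuitP cC.
have [B [sCB sB iB cB]] := rank_extend iCx (subset_trans (subsetDl _ _) sCX).
have xB : x \notin B.
  apply: contra dC => xB; apply: indep_sub iB.
  by rewrite -(setD1K xC) subUset sub1set xB.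
have : #|B| <= rank (X :\ x) by apply: leq_rank; rewrite // subsetD1 sB.
have := rankS (subsetDl X [set x]).
have := nullity_rank X; have := nullity_rank (X :\ x).
by have := cardsD1 x X; rewrite xX /=; lia.
Qed.

Lemma nullity_circuit C : C \in circuits M -> nullity C = 1.
Proof.
move=> cC; have [dC iC] := circuitP cC.
have [x xC] : exists x, x \in C.
  by apply/set0Pn; apply: contraNneq dC => ->; apply: indep0.
rewrite (nullityD1_circuit cC (subxx _) xC).
by move: (iC x xC); rewrite indep_nullity => /eqP->.
Qed.

Lemma nullity_dep X : X \notin indep M -> 0 < nullity X.
Proof. by rewrite indep_nullity lt0n. Qed.

(** An element of [C1] outside [C2] can be deleted from [X]; this lowers the nullity by one and
    leaves the dependent set [C2]. *)
Lemma nullity_2circuits C1 C2 X :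
  C1 \in circuits M -> C2 \in circuits M -> C1 != C2 ->
  C1 \subset X -> C2 \subset X -> 1 < nullity X.
Proof.
move=> c1 c2 ne s1 s2.
have /subsetPn[x x1 x2] : ~~ (C1 \subset C2).
  by apply: contra ne => /(circuit_min c2 (circuit_dep c1))/eqP.
rewrite (nullityD1_circuit c1 s1 x1) ltnS; apply: nullity_dep.
by apply: sub_dep (circuit_dep c2); rewrite subsetD1 s2.
Qed.

(** Deleting an element of a first circuit lowers the nullity by one only, so a second circuit
    survives, and it differs from the first by the deleted element. *)
Lemma nullity_ge2 X : 1 < nullity X ->
  exists C1 C2, [/\ C1 \in circuits M, C2 \in circuits M, C1 != C2 &
                    C1 :|: C2 \subset X].
Proof.
move=> n2; have [|C1 c1 s1] := @dep_circuit X.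
  by rewrite indep_nullity -lt0n ltnW.
have [x x1] : exists x, x \in C1.
  by apply/set0Pn; apply: contraNneq (circuit_dep c1) => ->; apply: indep0.
have [|C2 c2] := @dep_circuit (X :\ x).
  by move: n2; rewrite (nullityD1_circuit c1 s1 x1) indep_nullity -lt0n.
rewrite subsetD1 => /andP[s2 x2]; exists C1, C2; split=> //.
  by apply: contraNneq x2 => <-.
by rewrite subUset s1.
Qed.

(** For the dual of a graphic matroid these are the tribonds and dibonds together. *)
Definition double_circuits : {set {set E}} :=
  [set D | (nullity D == 2) &&
    [exists C1 in circuits M, exists C2 in circuits M, D == C1 :|: C2]].

Lemma double_circuitP D :
  reflect (nullity D = 2 /\
           exists C1 C2, [/\ C1 \in circuits M, C2 \in circuits M & D = C1 :|: C2])
          (D \in double_circuits).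
Proof.
rewrite inE; apply: (iffP andP) => -[].
  move=> /eqP n2 /exists_inP[C1 c1 /exists_inP[C2 c2 /eqP defD]].
  by split=> //; exists C1, C2.
move=> n2 [C1 [C2 [c1 c2 defD]]]; split; first exact/eqP.
by apply/exists_inP; exists C1 => //; apply/exists_inP; exists C2 => //; apply/eqP.
Qed.

Arguments double_circuitP {D}.

(** An element of [D] missed by [X] lies on one of the two circuits, so deleting it leaves nullity
    1, which bounds the nullity of [X]. *)
Lemma double_circuit_min D X :
  D \in double_circuits -> X \subset D -> 1 < nullity X -> X = D.
Proof.
case/double_circuitP=> n2 [C1 [C2 [c1 c2 defD]]] sXD nX.
apply/eqP; rewrite eqEsubset sXD; apply/subsetP => x xD; apply/negPn/negP => xX.
have [C cC [sCD xC]] : exists2 C, C \in circuits M & C \subset D /\ x \in C.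
  move: xD; rewrite {1}defD inE => /orP[xC|xC].
    by exists C1 => //; split=> //; rewrite defD subsetUl.
  by exists C2 => //; split=> //; rewrite defD subsetUr.
have sXDx : X \subset D :\ x by rewrite subsetD1 sXD.
by have := nullityS sXDx; move: n2; rewrite (nullityD1_circuit cC sCD xC); lia.
Qed.

End Nullity.

Arguments circuitP {E M C}.
Arguments baseP {E M B}.
Arguments double_circuitP {E M D}.

(** * Duality and the nullity of the dual *)

Section Duality.
Variables (E : finType) (M : matroid E).

Lemma dual_baseP (B : {set E}) : (B \in bases (dual M)) = (~: B \in bases M).
Proof.
have dualC A : A \in bases M -> ~: A \in indep (dual M).
  by move=> bA; apply/dual_indepP; exists A; rewrite // disjoints_subset.
apply/idP/idP.
  rewrite inE => /maxsetP[/dual_indepP[A bA]]; rewrite disjoints_subset => dBA mB.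
  by rewrite -(mB _ (dualC A bA) dBA) setCK.
move=> bB; rewrite inE; apply/maxsetP; split; first by rewrite -[B]setCK dualC.
move=> C /dual_indepP[A bA]; rewrite disjoint_sym disjoints_subset => sAC sBC.
have sAB : A \subset ~: B by apply: subset_trans sAC _; rewrite setCS.
have eAB : ~: B = A.
  move: bA bB; rewrite !inE => /maxsetP[_ mA] /maxsetP[iB _].
  exact: mA.
by apply/eqP; rewrite eqEsubset sBC andbT -setCS eAB.
Qed.

Lemma dualK : dual (dual M) = M.
Proof.
apply: matroid_ext; apply/setP => X; apply/dual_indepP/idP.
  case=> B; rewrite dual_baseP disjoints_subset inE => /maxsetP[iB _] sXB.
  exact: indep_sub sXB iB.
move=> iX; have [B [sXB _ iB cB]] := rank_extend iX (subsetT X).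
exists (~: B); last by rewrite disjoints_subset setCK.
by rewrite dual_baseP setCK; apply/baseP.
Qed.

(** A base of [M] extending a basis of the complement of [X] bounds the dual nullity from above; a
    base disjoint from a dual basis of [X] bounds it from below. The form as a sum avoids truncated
    subtraction. *)
Lemma nullity_dual (X : {set E}) :
  nullity (dual M) X + rank M (~: X) = rank M setT.
Proof.
apply/eqP; rewrite eqn_leq; apply/andP; split.
  have [I [sI iI cI]] := rank_basis M (~: X).
  have [B [sIB _ iB cB]] := rank_extend iI (subsetT I).
  have : #|X :\: B| <= rank (dual M) X.
    apply: leq_rank (subsetDl _ _); apply/dual_indepP; exists B.
      exact/baseP.
    by rewrite disjoints_subset; apply/subsetP=> x; rewrite !inE => /andP[].
  have := nullity_rank (dual M) X.
  have := cardsID B X; have := cardsID X B; rewrite setIC.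
  have : #|B :\: X| <= rank M (~: X).
    apply: leq_rank; first by apply: indep_sub iB; apply: subsetDl.
    by apply/subsetP=> x; rewrite !inE => /andP[].
  have : #|I| <= #|B :\: X|.
    apply: subset_leq_card; apply/subsetP=> x xI.
    by have := subsetP sI x xI; rewrite !inE (subsetP sIB x xI) andbT.
  by lia.
have [J [sJ /dual_indepP[B bB dJB] cJ]] := rank_basis (dual M) X.
have [iB cB] := baseP bB.
have : #|B :\: X| <= rank M (~: X).
  apply: leq_rank; first by apply: indep_sub iB; apply: subsetDl.
  by apply/subsetP=> x; rewrite !inE => /andP[].
have : #|B :&: X| + #|J| <= #|X|.
  rewrite -cardsUI (_ : _ :&: J = set0) ?cards0 ?addn0.
    by apply: subset_leq_card; rewrite subUset subsetIr.
  apply/eqP; rewrite setI_eq0 disjoint_sym; apply: disjointWr dJB.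
  exact: subsetIl.
have := nullity_rank (dual M) X; have := cardsID X B; lia.
Qed.

End Duality.

(** * Circuits of a matroid in terms of the contraction of one element *)

Section Contraction.
Variables (E : finType) (P : matroid (option E)) (Q : matroid E).
(** This expresses Q = P / e0; applied to the empty set, it also makes [None] a non-loop of [P]. *)
Hypothesis contr : forall X : {set E},
  (X \in indep Q) = (None |: Some @: X \in indep P).
Implicit Types (X Y B C D : {set E}) (Z : {set option E}).

Let s X : {set option E} := Some @: X.

Lemma mem_Some_imset X x : (Some x \in s X) = (x \in X).
Proof. by rewrite mem_imset // => ? ? []. Qed.

Lemma None_Some_imset X : None \notin s X.
Proof. by apply/imsetP => -[]. Qed.

Lemma subset_Some_imset X Y : (s X \subset s Y) = (X \subset Y).
Proof.
apply/idP/idP; last exact: imsetS.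
by move=> /subsetP h; apply/subsetP => x xX; rewrite -mem_Some_imset h ?mem_Some_imset.
Qed.

Lemma Some_imset_inj : injective s.
Proof. by move=> X Y eXY; apply/setP => x; rewrite -!mem_Some_imset eXY. Qed.

Lemma Some_imset_preim Z : None \notin Z -> Z = s [set x | Some x \in Z].
Proof.
move=> nZ; apply/setP => -[x|]; first by rewrite mem_Some_imset inE.
by rewrite (negPf nZ) (negPf (None_Some_imset _)).
Qed.

Lemma None_Some_imset_preim Z : None \in Z -> Z = None |: s [set x | Some x \in Z].
Proof.
by move=> nZ; apply/setP => -[x|]; rewrite !inE ?mem_Some_imset ?inE ?eqxx.
Qed.

Lemma Some_imsetD1 X x : s (X :\ x) = s X :\ Some x.
Proof.
apply/setP => -[y|]; rewrite !inE ?mem_Some_imset ?inE //=.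
by rewrite !(negPf (None_Some_imset _)).
Qed.

Lemma None_Some_imsetD1 X x : None |: s (X :\ x) = (None |: s X) :\ Some x.
Proof.
by rewrite Some_imsetD1; apply/setP => -[y|]; rewrite !inE ?mem_Some_imset.
Qed.

Lemma None_Some_imsetD0 X : (None |: s X) :\ None = s X.
Proof. by rewrite setU1K ?None_Some_imset. Qed.

Lemma indep_Some_imset X : X \in indep Q -> s X \in indep P.
Proof. by rewrite contr; apply: indep_sub; apply: subsetUr. Qed.

(** A basis of [X] in [Q] together with [None] is a basis of [None |: s X] in [P], so size and rank
    both grow by one. *)
Lemma nullity_contr X : nullity Q X = nullity P (None |: s X).
Proof.
have iN : [set None] \in indep P.
  apply: (@indep_sub _ _ _ (None |: s set0)); first exact: subsetUl.
  by rewrite -contr indep0.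
have := nullity_rank Q X; have := nullity_rank P (None |: s X).
rewrite cardsU1 None_Some_imset card_imset => [|? ? []//].
suff : rank P (None |: s X) = (rank Q X).+1 by lia.
apply/eqP; rewrite eqn_leq; apply/andP; split.
  have [J [sNJ sJ iJ <-]] := rank_extend iN (subsetUl _ (s X)).
  move: sNJ; rewrite sub1set => nJ.
  rewrite (cardsD1 None) nJ add1n ltnS.
  have := None_Some_imset_preim nJ; set I := [set _ | _] => defJ.
  rewrite defJ None_Some_imsetD0 card_imset => [|? ? []//].
  apply: leq_rank; first by rewrite contr -defJ.
  apply/subsetP => x; rewrite inE => /(subsetP sJ).
  by rewrite !inE mem_Some_imset.
have [I [sI iI <-]] := rank_basis Q X.
have -> : #|I|.+1 = #|None |: s I|.
  by rewrite cardsU1 None_Some_imset card_imset // => ? ? [].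
by apply: leq_rank; rewrite -?contr // setUS ?subset_Some_imset.
Qed.

(** When [Q] is the dual of the graphic matroid and [P] the dual of its extension, this is the
    linear class of bonds that the theorem asks for. *)
Definition lifted_circuits : {set {set E}} :=
  [set B in circuits Q | s B \in circuits P].

Lemma circuit_contr0 Z : Z \in circuits P -> None \in Z ->
  exists2 B, B \in circuits Q :\: lifted_circuits & Z = None |: s B.
Proof.
move=> cZ nZ; have := None_Some_imset_preim nZ; set B := [set _ | _] => defZ.
have [dZ iZ] := circuitP cZ.
exists B => //; rewrite in_setD; apply/andP; split.
  rewrite inE negb_and; apply/orP; right; apply/negP => csB.
  have eZ : s B = Z by apply: circuit_min cZ (circuit_dep csB) _; rewrite defZ subsetUr.
  by move: nZ; rewrite -eZ (negPf (None_Some_imset _)).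
apply/circuitP; split; first by rewrite contr -defZ.
move=> x xB; rewrite contr None_Some_imsetD1 -defZ iZ //.
by rewrite defZ !inE mem_Some_imset.
Qed.

(** If [s B] were dependent, a circuit of [P] inside it would come from a set dependent in [Q],
    hence from all of [B], and [B] would be lifted. *)
Lemma circuit_lift0 B : B \in circuits Q :\: lifted_circuits ->
  None |: s B \in circuits P.
Proof.
case/setDP=> cB nB; have [dB iB] := circuitP cB.
apply/circuitP; split; first by rewrite -contr.
move=> [x|]; rewrite !inE ?mem_Some_imset /=.
  by move=> xB; rewrite -None_Some_imsetD1 -contr iB.
rewrite None_Some_imsetD0 => _; apply: contraNT nB => /dep_circuit[Z cZ sZ].
have nZ : None \notin Z by apply: contra (None_Some_imset B); apply: (subsetP sZ).
have eZ := Some_imset_preim nZ; set C := [set _ | _] in eZ.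
suff eC : C = B by rewrite inE cB -eC -eZ.
apply: circuit_min cB _ _; last by rewrite -subset_Some_imset -eZ.
by apply: contra (circuit_dep cZ) => /indep_Some_imset; rewrite -eZ.
Qed.

Lemma circuit_contr D : s D \in circuits P ->
  D \in lifted_circuits \/
  D \in double_circuits Q /\ {in lifted_circuits, forall B, ~~ (B \subset D)}.
Proof.
move=> cD; have [cQD|ncQD] := boolP (D \in circuits Q).
  by left; rewrite inE cQD.
right; have dD : D \notin indep Q.
  by apply: contra (circuit_dep cD); apply: indep_Some_imset.
(* Every element of [D] lies on the circuit [s D] of [P], so its deletion lowers the nullity of
   [None |: s D]. *)
have nD x : x \in D -> nullity Q D = (nullity Q (D :\ x)).+1.
  move=> xD; rewrite !nullity_contr None_Some_imsetD1.
  by apply: nullityD1_circuit cD _ _; rewrite ?subsetUr ?mem_Some_imset.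
have le2 : nullity Q D <= 2.
  rewrite nullity_contr; have /andP[_] := nullityU1 P None (s D).
  by rewrite (nullity_circuit cD).
(* A circuit of [Q] inside [D] is proper, so deleting an element of [D] outside it leaves a positive
   nullity. *)
have ge2 : 1 < nullity Q D.
  have [B cB sBD] := dep_circuit dD.
  have [x xD xB] : exists2 x, x \in D & x \notin B.
    apply/subsetPn; apply: contra ncQD => sDB.
    by rewrite (_ : D = B) //; apply/eqP; rewrite eqEsubset sDB.
  rewrite (nD x xD) ltnS; apply: nullity_dep.
  by apply: sub_dep (circuit_dep cB); rewrite subsetD1 sBD.
split; last first.
  move=> B; rewrite inE => /andP[cB csB]; apply: contra ncQD => sBD.
  by rewrite -(Some_imset_inj (circuit_min cD (circuit_dep csB) _)) ?subset_Some_imset.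
apply/double_circuitP; split; first lia.
have [B1 [B2 [c1 c2 ne sD]]] := nullity_ge2 ge2; exists B1, B2; split=> //.
(* An [x] outside both circuits could be deleted with both surviving, whereas [nD] and [le2] leave
   nullity at most 1. *)
apply/eqP; rewrite eqEsubset sD andbT; apply/subsetP => x xD.
apply/negPn/negP => xB; have := nD x xD.
suff : 1 < nullity Q (D :\ x) by lia.
have: B1 :|: B2 \subset D :\ x by rewrite subsetD1 sD.
by rewrite subUset => /andP[]; apply: nullity_2circuits.
Qed.

(** The set [s D] has nullity at least 1 in [P], so it contains a circuit [s C]. As [C] is not
    lifted, it has nullity 2 in [Q], and minimality of [D] gives equality. *)
Lemma double_circuit_lift D : D \in double_circuits Q ->
  {in lifted_circuits, forall B, ~~ (B \subset D)} -> s D \in circuits P.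
Proof.
move=> dD nL; have [n2 _] := double_circuitP dD.
have [|Z cZ sZ] := @dep_circuit _ P (s D).
  rewrite indep_nullity; have /andP[_] := nullityU1 P None (s D).
  by rewrite -nullity_contr n2; lia.
have nZ : None \notin Z by apply: contra (None_Some_imset D); apply: (subsetP sZ).
have eZ := Some_imset_preim nZ; set C := [set _ | _] in eZ.
move: cZ sZ; rewrite eZ subset_Some_imset => cC sCD.
have [lC|[/double_circuitP[nC _] _]] := circuit_contr cC.
  by case/negP: (nL C lC).
by rewrite -(double_circuit_min dD sCD) // nC.
Qed.

Lemma circuits_contr :
  circuits P = [set s B | B in lifted_circuits]
    :|: [set None |: s B | B in circuits Q :\: lifted_circuits]
    :|: [set s D | D in [set D in double_circuits Q |
                          [forall B in lifted_circuits, ~~ (B \subset D)]]].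
Proof.
apply/setP => Z; apply/idP/idP => [cZ|].
  have [nZ|nZ] := boolP (None \in Z).
    have [B cB ->] := circuit_contr0 cZ nZ.
    by rewrite !inE (imset_f (fun B => None |: s B) cB) orbT.
  have eZ := Some_imset_preim nZ; rewrite eZ in cZ *.
  have [lD|[dD nD]] := circuit_contr cZ.
    by rewrite !inE imset_f.
  rewrite inE; apply/orP; right; apply: imset_f; rewrite inE dD.
  exact/forall_inP.
rewrite !in_setU => /orP[/orP[]|] /imsetP[B hB ->].
- by move: hB; rewrite inE => /andP[].
- exact: circuit_lift0.
- by move: hB; rewrite inE => /andP[dD /forall_inP nD]; apply: double_circuit_lift.
Qed.

(** Two circuits give [s D] nullity at least 2 in [P]. If [B3] were not lifted, [None |: s B3] would
    be a circuit of [P], and deleting [None] would leave [s D] with nullity at most 1. *)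
Lemma lifted_circuits_modular B1 B2 B3 D :
  B1 \in lifted_circuits -> B2 \in lifted_circuits -> B1 != B2 ->
  B3 \in circuits Q -> nullity Q D <= 2 ->
  B1 \subset D -> B2 \subset D -> B3 \subset D -> B3 \in lifted_circuits.
Proof.
rewrite inE => /andP[c1 l1]; rewrite inE => /andP[c2 l2] ne c3 le2 s1 s2 s3.
apply/negPn/negP => nl3.
have c03 : None |: s B3 \in circuits P.
  by apply: circuit_lift0; rewrite in_setD nl3.
have s03 : None |: s B3 \subset None |: s D by rewrite setUS ?subset_Some_imset.
have := nullityD1_circuit c03 s03 (setU11 _ _); rewrite -nullity_contr None_Some_imsetD0.
have : 1 < nullity P (s D).
  apply: nullity_2circuits l1 l2 _ _ _; rewrite ?subset_Some_imset //.
  by rewrite (inj_eq Some_imset_inj).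
by move=> ge2 eqn; rewrite eqn ltnS leqNgt ge2 in le2.
Qed.

(** A circuit of [P] through [None] yields a circuit of [Q] that is not lifted. Without such a
    circuit, [None] could be added to any base avoiding it, so it would be a coloop of [P]. *)
Lemma lifted_circuits_proper : [set None] \notin circuits (dual P) ->
  ~~ (circuits Q \subset lifted_circuits).
Proof.
apply: contra => sQL; apply/circuitP; split; last first.
  by move=> x; rewrite inE => /eqP->; rewrite setDv indep0.
apply/negP => /dual_indepP[B /baseP[iB cB]]; rewrite disjoints1 => nB.
have [|Z cZ sZ] := @dep_circuit _ P (None |: B).
  apply/negP => iNB; have := leq_rank iNB (subsetT _).
  by rewrite cardsU1 nB cB ltnn.
have [nZ|nZ] := boolP (None \in Z).
  have [C /setDP[cC nC] _] := circuit_contr0 cZ nZ.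
  by rewrite (subsetP sQL) in nC.
case/negP: (circuit_dep cZ); apply: indep_sub iB.
apply/subsetP => x xZ; have := subsetP sZ x xZ.
by rewrite !inE => /predU1P[ex|//]; rewrite -ex xZ in nZ.
Qed.

End Contraction.

(** * Deletion and contraction of the new element under duality *)

Lemma dual_delete0 (E : finType) (N : matroid (option E)) (X : {set E}) :
  ~ coloop N None ->
  (X \in indep (dual (delete0 N))) = (None |: Some @: X \in indep (dual N)).
Proof.
move=> ncl; have /dual_indepP[B0 bB0 nB0] : [set None] \in indep (dual N).
  apply/negPn/negP => dN; apply: ncl; apply/circuitP; split=> // x.
  by rewrite inE => /eqP->; rewrite setDv indep0.
rewrite disjoints1 in nB0.
have cs (B : {set E}) : #|Some @: B| = #|B| by rewrite card_imset // => ? ? [].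
(* The base [B0] avoids [None], so deletion keeps the rank and the bases of the deletion are the
   bases of [N] that avoid [None]. *)
have rkE : rank (delete0 N) setT = rank N setT.
  apply/eqP; rewrite eqn_leq; apply/andP; split.
    have [B [_ iB <-]] := rank_basis (delete0 N) setT.
    by rewrite -cs; apply: leq_rank (subsetT _); move: iB; rewrite inE.
  have [iB0 <-] := baseP bB0; rewrite (Some_imset_preim nB0) cs.
  by apply: leq_rank (subsetT _); rewrite inE -Some_imset_preim.
have bE (B : {set E}) : (B \in bases (delete0 N)) = (Some @: B \in bases N).
  by apply/baseP/baseP; rewrite inE cs rkE.
apply/dual_indepP/dual_indepP => -[B bB dB].
  exists (Some @: B); rewrite -?bE // -setI_eq0 setIUl setU_eq0 !setI_eq0.
  rewrite disjoints1 None_Some_imset -setI_eq0 -imsetI => [|? ? _ _ [] //].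
  by rewrite imset_eq0 setI_eq0.
move: dB; rewrite -setI_eq0 setIUl setU_eq0 !setI_eq0 disjoints1 => /andP[nB dB].
move: bB dB; rewrite (Some_imset_preim nB) -bE => bB dB; eexists; first exact: bB.
rewrite disjoints_subset; apply/subsetP => x xX; rewrite inE; apply/negP => xB.
have : Some x \in Some @: X by rewrite mem_Some_imset.
by move=> /(disjointFr dB); rewrite mem_Some_imset xB.
Qed.

(** By [dualK], the dual of the contraction is the deletion of e0 from the dual, whose circuits are
    the old ones avoiding e0. *)
Lemma cocircuits_contract0 (E : finType) (N : matroid (option E)) :
  cocircuits (contract0 N) = [set X : {set E} | (Some @: X) \in cocircuits N].
Proof.
rewrite /cocircuits /contract0 dualK; apply/setP => X; rewrite [RHS]inE.
apply/circuitP/circuitP => -[dX iX]; split; rewrite ?inE // in dX *.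
  by move=> _ /imsetP[x xX ->]; have := iX x xX; rewrite inE [Some @: _]Some_imsetD1.
by move=> x xX; rewrite inE [Some @: _]Some_imsetD1 iX // mem_Some_imset.
Qed.

(** * The rank of the graphic matroid and the number of components *)

Section Graphs.
Variable G : graph.
Implicit Types (e f : edge G) (u v x y z : vertex G) (X Y : {set vertex G}).
Implicit Types (F I B D : {set edge G}).

Local Notation M := (graphic_matroid G).
Local Notation comp F x := [set y | connect (adj F) x y].

Lemma basis_spans F I : I \subset F -> I \in indep M -> #|I| = rank M F ->
  {in F, forall e, spans I e}.
Proof.
move=> sIF iI cI e eF; apply/negPn/negP => nsp.
have eI : e \notin I by apply: contra nsp; apply: spans_mem.
have : #|e |: I| <= rank M F.
  apply: leq_rank; last by rewrite subUset sub1set eF.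
  by apply/forestsP; apply: forestU1 nsp; apply/forestsP.
by rewrite cardsU1 eI -cI ltnn.
Qed.

Lemma leq_rank_spans F F' : {in F', forall e, spans F e} -> rank M F' <= rank M F.
Proof.
move=> sF; have [I [sI iI cI]] := rank_basis M F'; rewrite -cI.
have [J [sJ iJ cJ]] := rank_basis M F; rewrite -cJ.
apply: forest_leq; first exact/forestsP.
move=> e /(subsetP sI)/sF; apply: spans_conn; exact: basis_spans.
Qed.

Lemma conn_comp F x y : connect (adj F) x y -> comp F x = comp F y.
Proof.
move=> cxy; apply/setP => z; rewrite !inE.
exact: (same_connect (sym_connect_sym (@adj_sym G F)) cxy).
Qed.

Lemma mem_components F x : comp F x \in components F.
Proof. exact: imset_f. Qed.

(** By induction on the path, repeated uses of [e] collapse, so a single crossing in one of the two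
    directions is enough. *)
Lemma connect_setU1 e F x y : let u := (ends e).1 in let v := (ends e).2 in
  connect (adj (e |: F)) x y = [|| connect (adj F) x y,
     connect (adj F) x u && connect (adj F) v y
   | connect (adj F) x v && connect (adj F) u y].
Proof.
move=> u v; have sF : F \subset e |: F by apply: subsetUr.
have cuv : connect (adj (e |: F)) u v by apply: spans_mem; apply: setU11.
apply/idP/idP; last first.
  case/or3P=> [|/andP[c1 c2]|/andP[c1 c2]]; first exact: conn_sub.
    apply: connect_trans (conn_sub sF c1) _.
    exact: connect_trans cuv (conn_sub sF c2).
  apply: connect_trans (conn_sub sF c1) _; rewrite conn_sym in cuv.
  exact: connect_trans cuv (conn_sub sF c2).
case/connectP=> p; elim: p x => [|z p IH] x /=; first by move=> _ ->; rewrite connect0.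
case/andP=> /exists_inP[f]; rewrite !inE => /predU1P[->|fF] j pth lst.
  have := IH _ pth lst; move: j; rewrite /joins -/(ends e).
  rewrite [ends e]surjective_pairing -/u -/v !xpair_eqE.
  case/orP=> /andP[/eqP<- /eqP<-] /or3P[h|/andP[_ h]|/andP[_ h]];
    by rewrite ?h ?connect0 ?orbT //.
have cxz : connect (adj F) x z by apply: connect1; apply/exists_inP; exists f.
have := IH _ pth lst => /or3P[h|/andP[h1 h2]|/andP[h1 h2]].
- by rewrite (connect_trans cxz h).
- by rewrite (connect_trans cxz h1) h2 orbT.
- by rewrite (connect_trans cxz h1) h2 !orbT.
Qed.

Lemma card_components_setU1 e F : ~~ spans F e ->
  #|components F| = #|components (e |: F)|.+1.
Proof.
rewrite /spans; set u := (ends e).1; set v := (ends e).2 => nuv.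
have cU x y : connect (adj (e |: F)) x y = [|| connect (adj F) x y,
     connect (adj F) x u && connect (adj F) v y
   | connect (adj F) x v && connect (adj F) u y] by exact: connect_setU1.
rewrite (cardsD1 (comp F v)) mem_components add1n; congr _.+1.
(* Adding e merges the component of v into that of u, so h maps the components
   of F other than that of v bijectively onto those of e |: F. *)
pose h (C : {set vertex G}) := if C == comp F u then comp F u :|: comp F v else C.
have hE x : ~~ connect (adj F) v x -> h (comp F x) = comp (e |: F) x.
  move=> nvx; rewrite /h; case: eqP => [eux|/eqP neux].
    have cux : connect (adj F) u x.
      have : x \in comp F x by rewrite inE connect0.
      by rewrite eux inE.
    apply/setP => y; rewrite !inE cU.
    rewrite (conn_sym F x u) cux (conn_sym F x v) (negPf nvx) /= orbF.
    congr (_ || _).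
    exact: (same_connect (sym_connect_sym (@adj_sym G F)) cux).
  have nxu : ~~ connect (adj F) x u.
    by apply: contra neux => /conn_comp ->.
  apply/setP => y; rewrite !inE cU (negPf nxu) conn_sym.
  by rewrite (conn_sym F x v) (negPf nvx) orbF conn_sym.
have hC : h @: (components F :\ comp F v) = components (e |: F).
  apply/setP => C; apply/imsetP/imsetP => -[].
    move=> C0 /setD1P[ne /imsetP[x _ eC0]] ->; exists x => //.
    rewrite {}eC0 in ne *; apply: hE; apply: contra ne => /conn_comp ->; exact: eqxx.
  move=> x _ ->; have [vx|nvx] := boolP (connect (adj F) v x).
    exists (comp F u).
      rewrite !inE mem_components andbT; apply: contra nuv => /eqP euv.
      have : v \in comp F v by rewrite inE connect0.
      by rewrite -euv inE.
    rewrite hE 1?conn_sym //; apply: conn_comp.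
    by rewrite cU (conn_sym F x v) vx connect0 !orbT.
  exists (comp F x); last by rewrite hE.
  rewrite in_setD1 mem_components andbT; apply: contra nvx => /eqP exv.
  have : x \in comp F x by rewrite inE connect0.
  by rewrite exv inE.
(* Injectivity of [h]: if [x] and [y] became connected only through [e], one of them would lie in
   the component of [v], which is excluded. *)
rewrite -hC card_in_imset // => C1 C2.
have disj C x : C \in components F :\ comp F v -> C = comp F x -> x \notin comp F v.
  move=> /setD1P[ne _] eC; apply: contra ne; rewrite inE => /conn_comp ->.
  by rewrite eC.
move=> m1 m2; have /setD1P[_ /imsetP[x _ e1]] := m1.
have /setD1P[_ /imsetP[y _ e2]] := m2.
have n1 := disj _ _ m1 e1; have n2 := disj _ _ m2 e2.
rewrite e1 e2 !hE; try by move: n1 n2; rewrite !inE.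
move=> eh; apply: conn_comp.
have : y \in comp (e |: F) y by rewrite inE connect0.
rewrite -eh inE cU => /or3P[//|/andP[_ h1]|/andP[h1 _]].
  by move: n2; rewrite inE h1.
by move: n1; rewrite inE conn_sym h1.
Qed.

Lemma components_spans F F' : F \subset F' -> {in F', forall e, spans F e} ->
  components F = components F'.
Proof.
move=> sF sp; apply: eq_imset => x; apply/setP => y; rewrite !inE.
by apply/idP/idP; [apply: conn_sub | apply: spans_conn].
Qed.

Lemma card_components_forest F : F \in indep M -> #|F| + #|components F| = #|vertex G|.
Proof.
have [n] := ubnP #|F|; elim: n F => // n IH F ltn iF.
have [->|[e eF]] := set_0Vmem F.
  have c0 x : comp set0 x = [set x].
    apply/setP => y; rewrite !inE; apply/idP/eqP => [|->]; last exact: connect0.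
    case/connectP=> -[|z p] //= /andP[/exists_inP[f]].
    by rewrite inE.
  rewrite cards0 add0n /components card_imset // => x y; rewrite !c0.
  exact: set1_inj.
have ltF : #|F :\ e| < n by move: ltn; rewrite (cardsD1 e) eF.
have iFe : F :\ e \in indep M by apply: indep_sub iF; apply: subsetDl.
rewrite -(IH _ ltF iFe) (@card_components_setU1 e (F :\ e)) ?setD1K //.
  by rewrite (cardsD1 e F) eF addnS.
by apply: spans_forest; rewrite ?setD1K ?setD11 //; apply/forestsP.
Qed.

(** A maximal forest in [F] has the same components as [F], so the count for forests is enough. *)
Lemma rank_components F : rank M F + #|components F| = #|vertex G|.
Proof.
have [I [sI iI cI]] := rank_basis M F; rewrite -cI -(card_components_forest iI).
by rewrite (components_spans sI) //; apply: basis_spans.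
Qed.

(** * Edge cuts, and bonds as cocircuits *)

Lemma delta_join X e x y : joins e x y -> (e \in delta X) = (x \in X) (+) (y \in X).
Proof. by rewrite inE => /orP[] /eqP -> //=; rewrite addbC. Qed.

(** A set is dependent in the dual when its removal lowers the rank, that is, separates the ends of
    some edge. *)
Lemma cocircuit_depP D : reflect (exists X, delta X != set0 /\ delta X \subset D)
  (D \notin indep (dual M)).
Proof.
have -> : (D \notin indep (dual M)) = [exists e, ~~ spans (~: D) e].
  have nd := nullity_dual M D; rewrite indep_nullity.
  apply/idP/idP => [n0|/existsP[e nsp]].
    apply: contraNT n0; rewrite negb_exists => /forallP sp.
    have : rank M setT <= rank M (~: D).
      by apply: leq_rank_spans => e _; have := sp e; rewrite negbK.
    lia.
  have eI F : F \subset ~: D -> e \notin F.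
    by move=> sF; apply: contra nsp => eF; apply: spans_mem; apply: (subsetP sF).
  have [I [sI iI cI]] := rank_basis M (~: D).
  have : #|e |: I| <= rank M setT.
    apply: leq_rank (subsetT _); apply/forestsP; apply: forestU1.
      exact/forestsP.
    by apply: contra nsp; apply: conn_sub.
  by rewrite cardsU1 (eI I) //; lia.
apply: (iffP existsP) => [[e nsp]|[X [/set0Pn[e eX] sXD]]].
  (* The witness is a component after removal of [D]; any edge leaving it must lie in [D]. *)
  exists (comp (~: D) (ends e).1); split.
    by apply/set0Pn; exists e; rewrite !inE connect0 /=.
  apply/subsetP => f; rewrite -[f \in D]negbK -in_setC; apply: contraL => fD.
  rewrite (delta_join _ (joins_ends f)) !inE.
  have cf := spans_mem fD.
  rewrite (same_connect_r (sym_connect_sym (@adj_sym G (~: D))) cf).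
  by rewrite addbb.
exists e; rewrite /spans; apply/negP => /connectP[p pth lst].
(* A path avoiding [D] never crosses [delta X]. *)
have inX x : path (adj (~: D)) x p -> (x \in X) = (last x p \in X).
  elim: p x {pth lst} => //= y p IH x /andP[/exists_inP[f fD j] /IH <-].
  have : f \notin delta X by apply: contraL fD => fX; rewrite inE negbK (subsetP sXD).
  by rewrite (delta_join _ j); case: (x \in X); case: (y \in X).
by move: eX; rewrite inE lst (inX _ pth) addbb.
Qed.

(** By [cocircuit_depP], the dependent sets of the dual are the supersets of nonempty cuts, so both
    sides have the same minimal members. *)
Lemma bonds_cocircuits : bonds G = circuits (dual M).
Proof.
apply/setP => B; rewrite inE; apply/minsetP/circuitP.
  move=> [/andP[B0 /existsP[X /eqP eB]] mB]; split.
    by apply/cocircuit_depP; exists X; rewrite -eB.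
  move=> e eiB; apply/negPn/negP => /cocircuit_depP[Y [Y0 sY]].
  have eY : delta Y = B.
    apply: mB; last by apply: subset_trans sY (subsetDl _ _).
    by rewrite Y0; apply/existsP; exists Y.
  by have := subsetP sY e; rewrite eY eiB !inE eqxx => /(_ isT).
move=> cB; have /circuitP cB' := cB.
have key Y : delta Y != set0 -> delta Y \subset B -> delta Y = B.
  move=> Y0 sY; apply: circuit_min cB' _ sY.
  by apply/cocircuit_depP; exists Y.
have [/cocircuit_depP[X [X0 sX]] _] := cB; split.
  by rewrite -(key X) // X0; apply/existsP; exists X.
by move=> C /andP[C0 /existsP[Y /eqP eY]]; rewrite eY in C0 *; apply: key.
Qed.

Lemma delta_conn F X x y : [disjoint F & delta X] ->
  connect (adj F) x y -> (x \in X) = (y \in X).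
Proof.
move=> dF /connectP[p + ->]; elim: p x => //= y' p IH x /andP[/exists_inP[f fF j] /IH <-].
have := disjointFr dF fF.
by rewrite (delta_join _ j); case: (x \in X); case: (y' \in X).
Qed.

(** * Connected vertex sets and their cuts *)

Lemma edge_betweenP X Y :
  reflect (exists e x y, [/\ joins e x y, x \in X & y \in Y]) (edge_between X Y).
Proof.
apply: (iffP existsP) => [[e /exists_inP[x xX]]|[e [x [y [j xX yY]]]]].
  by case/exists_inP=> y yY j; exists e, x, y.
by exists e; apply/exists_inP; exists x => //; apply/exists_inP; exists y.
Qed.

Lemma edge_betweenC X Y : edge_between X Y = edge_between Y X.
Proof.
by apply/edge_betweenP/edge_betweenP => -[e [x [y [j xX yY]]]];
  exists e, y, x; rewrite joinsC.
Qed.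

Lemma connected_conn F X x y : connected_on X ->
  (forall e u v, joins e u v -> u \in X -> v \in X -> e \in F) ->
  x \in X -> y \in X -> connect (adj F) x y.
Proof.
case/andP=> _ /forall_inP cX hF xX yX; have /forall_inP/(_ y yX) := cX x xX.
apply: connect_sub => u v /and3P[uX vX /exists_inP[e _ j]].
by apply: connect1; apply/exists_inP; exists e => //; apply: hF j uX vX.
Qed.

Lemma connected_onU X Y : connected_on X -> connected_on Y -> edge_between X Y ->
  connected_on (X :|: Y).
Proof.
move=> cX cY /edge_betweenP[e [a [b [j aX bY]]]].
pose r u v := [&& u \in X :|: Y, v \in X :|: Y & adj setT u v].
have rsym : connect_sym r.
  by apply: sym_connect_sym => u v; rewrite /r adj_sym andbCA.
have sub Z : connected_on Z -> Z \subset X :|: Y ->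
    {in Z &, forall x y, connect r x y}.
  case/andP=> _ /forall_inP cZ /subsetP sZ x y xZ yZ.
  have /forall_inP/(_ y yZ) := cZ x xZ.
  apply: connect_sub => u v /and3P[uZ vZ auv].
  by apply: connect1; rewrite /r !sZ.
have ca x : x \in X :|: Y -> connect r x a.
  rewrite inE => /orP[xX|xY]; first by apply: (sub X); rewrite ?subsetUl.
  apply: connect_trans (_ : connect r x b) _; first by apply: (sub Y); rewrite ?subsetUr.
  rewrite rsym; apply: connect1; rewrite /r !inE aX bY orbT /=.
  by apply/exists_inP; exists e; rewrite ?inE.
apply/andP; split; first by apply/set0Pn; exists a; rewrite inE aX.
apply/forall_inP => x xXY; apply/forall_inP => y yXY.
by apply: connect_trans (ca x xXY) _; rewrite rsym; apply: ca.
Qed.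

Lemma component_joins X e x y : X \in components setT -> joins e x y ->
  (x \in X) = (y \in X).
Proof.
case/imsetP=> z _ -> j; rewrite !inE.
apply: (same_connect_r (sym_connect_sym (@adj_sym G setT))).
by apply: connect1; apply/exists_inP; exists e; rewrite ?inE.
Qed.

Lemma delta_split X Y e : X :|: Y \in components setT -> e \in delta X ->
  exists x y, [/\ joins e x y, x \in X & y \in Y].
Proof.
move=> cXY; have j := joins_ends e; have := component_joins cXY j.
rewrite (delta_join _ j) !inE.
case: (boolP (_ \in X)) => x1; case: (boolP (_ \in X)) => x2 //=.
  by exists (ends e).1, (ends e).2.
by move=> y1 _; exists (ends e).2, (ends e).1; rewrite joinsC.
Qed.

(** For a nonempty cut [delta Z] inside [delta X], membership in [Z] is constant on each of the
    connected sets [X] and [Y] and differs between them, so every edge joining [X] to [Y] lies in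
    [delta Z]. *)
Lemma delta_bond X Y : connected_on X -> connected_on Y -> [disjoint X & Y] ->
  X :|: Y \in components setT -> edge_between X Y -> delta X \in bonds G.
Proof.
move=> cX cY dXY cXY /edge_betweenP[e0 [x0 [y0 [j0 x0X y0Y]]]].
rewrite inE; apply/minsetP; split.
  apply/andP; split; last by apply/existsP; exists X.
  by apply/set0Pn; exists e0; rewrite (delta_join _ j0) x0X (disjointFl dXY y0Y).
move=> C /andP[C0 /existsP[Z /eqP eC]]; rewrite {C}eC in C0 *; move=> sZX.
have dZ F : F = ~: delta Z -> [disjoint F & delta Z].
  by move->; rewrite disjoints_subset subxx.
have inZ W : connected_on W ->
    (forall u v, u \in W -> v \in W -> (u \in X) = (v \in X)) ->
    {in W &, forall u v, (u \in Z) = (v \in Z)}.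
  move=> cW hW u v uW vW; apply: delta_conn (dZ _ erefl) _.
  apply: connected_conn cW _ uW vW => e u' v' j uW' vW'.
  rewrite inE; apply/negP => /(subsetP sZX); rewrite (delta_join _ j).
  by rewrite (hW u' v') // addbb.
have ZX : {in X &, forall u v, (u \in Z) = (v \in Z)}.
  by apply: inZ cX _ => u v -> ->.
have ZY : {in Y &, forall u v, (u \in Z) = (v \in Z)}.
  by apply: inZ cY _ => u v uY vY; rewrite !(disjointFl dXY).
apply/eqP; rewrite eqEsubset sZX; apply/subsetP => e eX.
have [f fZ] := set0Pn _ C0.
have [x [y [j xX yY]]] := delta_split cXY eX.
have [x' [y' [j' xX' yY']]] := delta_split cXY (subsetP sZX f fZ).
move: fZ; rewrite (delta_join _ j) (delta_join _ j').
by rewrite (ZX x x') // (ZY y y').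
Qed.

(** * Tripartitions, tribonds and dibonds *)

Lemma tripartition_swap X1 X2 X3 : tripartition X1 X2 X3 -> tripartition X2 X1 X3.
Proof.
case/and4P=> c /and3P[d12 d13 d23] /and3P[c1 c2 c3] /and3P[e12 e13 e23].
by rewrite /tripartition (setUC X2) c disjoint_sym d12 d13 d23 c1 c2 c3 edge_betweenC
  e12 e13 e23.
Qed.

Lemma tripartition_rot X1 X2 X3 : tripartition X1 X2 X3 -> tripartition X2 X3 X1.
Proof.
case/and4P=> c /and3P[d12 d13 d23] /and3P[c1 c2 c3] /and3P[e12 e13 e23].
rewrite /tripartition setUC setUA c d23 !(disjoint_sym _ X1) d12 d13.
by rewrite c1 c2 c3 !(edge_betweenC _ X1) e12 e13 e23.
Qed.

Lemma tripartition_bond X1 X2 X3 : tripartition X1 X2 X3 -> delta X1 \in bonds G.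
Proof.
case/and4P=> c /and3P[d12 d13 d23] /and3P[c1 c2 c3] /and3P[e12 e13 e23].
apply: (@delta_bond _ (X2 :|: X3)) => //; rewrite ?setUA //.
- exact: connected_onU.
- by rewrite -setI_eq0 setIUr setU_eq0 !setI_eq0 d12.
case/edge_betweenP: e12 => [e [x [y [j xX yY]]]].
by apply/edge_betweenP; exists e, x, y; rewrite inE yY.
Qed.

(** An edge between [X1] and [X3] lies in the first cut but not in the second. *)
Lemma tripartition_delta_neq X1 X2 X3 : tripartition X1 X2 X3 -> delta X1 != delta X2.
Proof.
case/and4P=> c /and3P[d12 d13 d23] _ /and3P[_ /edge_betweenP[e [x [y [j xX yY]]]] _].
apply/negP => /eqP/setP/(_ e); rewrite !(delta_join _ j) xX.
by rewrite (disjointFl d13 yY) (disjointFr d12 xX) (disjointFl d23 yY).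
Qed.

Lemma tripartition_delta_sub X1 X2 X3 :
  tripartition X1 X2 X3 -> delta X1 \subset delta X2 :|: delta X3.
Proof.
case/and4P=> c /and3P[d12 d13 d23] _ _; apply/subsetP => e.
rewrite -setUA in c => /(delta_split c)[x [y [j xX]]].
rewrite !in_setU !(delta_join _ j) => /orP[] ->.
  by rewrite (disjointFr d12 xX).
by rewrite (disjointFr d13 xX) orbT.
Qed.

(** One edge from [X1] to [X2] and one from [X1] to [X3] reconnect the component after the three
    cuts are removed, so the removal lowers the rank by at most 2. *)
Lemma tripartition_nullity X1 X2 X3 : tripartition X1 X2 X3 ->
  nullity (dual M) (delta X1 :|: delta X2 :|: delta X3) <= 2.
Proof.
case/and4P=> c /and3P[d12 d13 d23] /and3P[c1 c2 c3].
case/and3P=> /edge_betweenP[a [x1 [x2 [ja x1X x2X]]]].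
move=> /edge_betweenP[b [y1 [x3 [jb y1X x3X]]]] _.
set D := _ :|: _ :|: _; pose F := a |: (b |: ~: D).
suff sF : {in setT, forall e, spans F e}.
  have := nullity_dual M D; have := leq_rank_spans sF.
  have := rankU1 M a (b |: ~: D); have := rankU1 M b (~: D); rewrite -/F.
  lia.
have conn X : connected_on X ->
    (forall u v, u \in X -> v \in X ->
       [/\ (u \in X1) = (v \in X1), (u \in X2) = (v \in X2) & (u \in X3) = (v \in X3)]) ->
    {in X &, forall x y, connect (adj F) x y}.
  move=> cX hX x y; apply: connected_conn cX _ => e u v j uX vX.
  rewrite !in_setU in_setC !in_setU !(delta_join _ j).
  by have [-> -> ->] := hX u v uX vX; rewrite !addbb !orbT.
have conn1 : {in X1 &, forall x y, connect (adj F) x y}.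
  apply: conn => // u v uX vX.
  by rewrite uX vX !(disjointFr d12) // !(disjointFr d13).
have conn2 : {in X2 &, forall x y, connect (adj F) x y}.
  apply: conn => // u v uX vX.
  by rewrite uX vX !(disjointFl d12) // !(disjointFr d23).
have conn3 : {in X3 &, forall x y, connect (adj F) x y}.
  apply: conn => // u v uX vX.
  by rewrite uX vX !(disjointFl d13) // !(disjointFl d23).
have ca : connect (adj F) x1 x2.
  by apply: connect1; apply/exists_inP; exists a; rewrite // !inE eqxx.
have cb : connect (adj F) y1 x3.
  by apply: connect1; apply/exists_inP; exists b; rewrite // !inE eqxx orbT.
have toX1 x : x \in X1 :|: X2 :|: X3 -> connect (adj F) x1 x.
  rewrite !inE => /orP[/orP[xX|xX]|xX]; first exact: conn1.
    by apply: connect_trans ca _; apply: conn2.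
  apply: connect_trans (conn1 _ _ x1X y1X) _.
  by apply: connect_trans cb _; apply: conn3.
move=> e _; have [eD|eD] := boolP (e \in D); last first.
  by apply: spans_mem; rewrite /F !in_setU1 in_setC eD !orbT.
have j := joins_ends e; have eC := component_joins c j.
have e1C : (ends e).1 \in X1 :|: X2 :|: X3.
  move: eD; rewrite !in_setU !(delta_join _ j); move: eC; rewrite !in_setU.
  by do 6![case: (_ \in _)].
rewrite /spans; apply: (@connect_trans _ _ x1); last by rewrite toX1 // -eC.
by rewrite conn_sym toX1.
Qed.

(** By [rank_components], the two extra components of a modular pair mean that its union has dual
    nullity 2. A tribond is the union of two of its bonds, and a union of a modular pair that is not
    a tribond is a dibond by definition. *)
Lemma tribonds_dibonds : tribonds G :|: dibonds G = double_circuits (dual M).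
Proof.
have modular B1 B2 : modular_pair B1 B2 =
    [&& B1 \in circuits (dual M), B2 \in circuits (dual M) &
        nullity (dual M) (B1 :|: B2) == 2].
  rewrite /modular_pair bonds_cocircuits; congr [&& _, _ & _].
  have := nullity_dual M (B1 :|: B2).
  have := rank_components (~: (B1 :|: B2)); have := rank_components [set: edge G].
  by move=> h1 h2 h3; apply/eqP/eqP; lia.
apply/setP => D; apply/idP/idP; rewrite in_setU.
  case/orP.
    rewrite inE => /existsP[X1 /existsP[X2 /existsP[X3 /andP[t /eqP eD]]]].
    have b1 := tripartition_bond t; have b2 := tripartition_bond (tripartition_swap t).
    rewrite bonds_cocircuits in b1 b2.
    apply/double_circuitP; split; last first.
      exists (delta X1), (delta X2); split=> //; rewrite eD; apply/setUidPl.
      by apply: tripartition_delta_sub; do 2!apply: tripartition_rot.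
    apply/eqP; rewrite eqn_leq eD tripartition_nullity //=.
    apply: nullity_2circuits b1 b2 (tripartition_delta_neq t) _ _.
      by rewrite -setUA subsetUl.
    by rewrite setUAC subsetUr.
  rewrite inE => /andP[_ /existsP[B1 /existsP[B2 /andP[]]]].
  rewrite modular => /and3P[c1 c2 /eqP n2] /eqP eD; apply/double_circuitP.
  by rewrite eD; split=> //; exists B1, B2.
case/double_circuitP=> n2 [B1 [B2 [c1 c2 eD]]].
rewrite orbC [D \in dibonds G]inE; case: (D \in tribonds G); rewrite ?orbT //= orbF.
apply/existsP; exists B1; apply/existsP; exists B2.
by rewrite modular c1 c2 -eD n2 !eqxx.
Qed.

Lemma linear_class_lifted (P : matroid (option (edge G))) :
  (forall X : {set edge G}, (X \in indep (dual M)) = (None |: Some @: X \in indep P)) ->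
  linear_class (lifted_circuits P (dual M)).
Proof.
move=> contr; split.
  by rewrite bonds_cocircuits; apply/subsetP => B; rewrite inE => /andP[].
move=> X1 X2 X3 t.
have lin Y1 Y2 Y3 : tripartition Y1 Y2 Y3 ->
    delta Y1 \in lifted_circuits P (dual M) -> delta Y2 \in lifted_circuits P (dual M) ->
    delta Y3 \in lifted_circuits P (dual M).
  move=> tY l1 l2.
  have b3 : delta Y3 \in circuits (dual M).
    by rewrite -bonds_cocircuits; apply: tripartition_bond;
      do 2!apply: tripartition_rot; exact: tY.
  apply: (lifted_circuits_modular contr l1 l2) b3 (tripartition_nullity tY) _ _ _.
  - exact: tripartition_delta_neq tY.
  - by rewrite -setUA subsetUl.
  - by rewrite setUAC subsetUr.
  - exact: subsetUr.
(* The rotations show that any two of the three bonds in the class force the third, so the count is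
   never two. *)
have l3 := lin _ _ _ t; have l1 := lin _ _ _ (tripartition_rot t).
have l2 := lin _ _ _ (tripartition_rot (tripartition_rot t)).
move: l1 l2 l3; do 3!case: (delta _ \in _) => //=; move=> h1 h2 h3 _;
  by first [have := h1 isT isT | have := h2 isT isT | have := h3 isT isT].
Qed.

End Graphs.

(** * Cocircuits of the quotient, and the form of every elementary quotient *)

Theorem theorem3p2 (G : graph) :
  (forall (L : {set {set edge G}}) (J0 : matroid (option (edge G))),
     linear_class L -> nontrivial L -> complete_join L J0 ->
     cocircuits (contract0 J0) =
       L :|: [set D in tribonds G :|: dibonds G |
                [forall B in L, ~~ (B \subset D)]])
  /\
  (forall N : matroid (edge G),
     elementary_quotient (graphic_matroid G) N ->
     exists (L : {set {set edge G}}) (J0 : matroid (option (edge G))),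
       [/\ linear_class L, nontrivial L, complete_join L J0 & N = contract0 J0]).
Proof.
split=> [L J0 _ _ cJ|N [N' [delN nloop ncoloop ->]]].
  rewrite cocircuits_contract0 cJ; apply/setP => X; rewrite inE !in_setU.
  have memS (A : {set {set edge G}}) :
      (Some @: X \in [set Some @: B | B : {set edge G} in A]) = (X \in A).
    by rewrite mem_imset //; apply: Some_imset_inj.
  (* Every member of the middle family contains [None], so it contributes nothing to the
     contraction. *)
  rewrite !memS (_ : Some @: X \in _ = false) ?orbF //.
  apply/imsetP => -[B _ /setP/(_ None)].
  by rewrite in_setU1 eqxx (negPf (None_Some_imset X)).
(* As e0 is not a coloop of [N'], the dual of M(G) is the contraction of e0 in the dual of [N']. *)
have contr X : (X \in indep (dual (graphic_matroid G))) =
    (None |: Some @: X \in indep (dual N')).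
  by rewrite -delN; apply: dual_delete0.
(* The extension [N'] is itself the complete join, for the class of bonds that are cocircuits of
   [N']. *)
exists (lifted_circuits (dual N') (dual (graphic_matroid G))), N'; split=> //.
- exact: linear_class_lifted.
(* Non-triviality comes from e0 not being a loop of [N'], that is, not a coloop of its dual. *)
- rewrite /nontrivial bonds_cocircuits; apply: lifted_circuits_proper => //.
  by rewrite dualK; apply/negP.
- rewrite /complete_join bonds_cocircuits tribonds_dibonds.
  exact: circuits_contr.
Qed.
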